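(* Let $\Lambda\subseteq\mathbb{R}^d$ be a Meyer set. Then $\Lambda$ is a fully Euclidean Meyer set if and only if $$\operatorname{ap-rank}(\Lambda)=\operatorname{rank}(\Lambda).$$
   Context: Here $d\ge 1$ and $B_R(x)$ denotes the ball of radius $R$ centred at $x$. A set $\Lambda\subseteq\mathbb{R}^d$ is relatively dense if there is $R>0$ such that every ball $B_R(x)$, $x\in\mathbb{R}^d$, contains a point of $\Lambda$; it is uniformly discrete if there is $r>0$ such that every ball $B_r(x)$ contains at most one point of $\Lambda$. A Meyer set is a relatively dense set $\Lambda\subseteq\mathbb{R}^d$ such that $\Lambda-\Lambda$ is uniformly discrete. A fully Euclidean cut and project scheme (CPS) $(\mathbb{R}^d,\mathbb{R}^m,\mathcal{L})$, $m\ge 0$ an integer, consists of $\mathbb{R}^d$, $\mathbb{R}^m$ and a lattice (discrete co-compact subgroup) $\mathcal{L}\subset\mathbb{R}^d\times\mathbb{R}^m$ such that the canonical projection to $\mathbb{R}^d$ is injective on $\mathcal{L}$ and the image of $\mathcal{L}$ under the canonical projection to $\mathbb{R}^m$ is dense in $\mathbb{R}^m$. For $W\subseteq\mathbb{R}^m$, $\curlywedge(W):=\{x\in\mathbb{R}^d : \exists\, y\in W \text{ with } (x,y)\in\mathcal{L}\}$. It is called a fully Euclidean model set when $W$ is precompact and has non-empty interior. A relatively dense set $\Lambda\subseteq\mathbb{R}^d$ is a fully Euclidean Meyer set if there exists some fully Euclidean model set $\curlywedge(W)$ (in some fully Euclidean CPS $(\mathbb{R}^d,\mathbb{R}^m,\mathcal{L})$)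 with $\Lambda\subseteq\curlywedge(W)$. An li-arithmetic progression of length $N$ and rank $k$ is a set $\{s+c_1r_1+\dots+c_kr_k : c_j\in\mathbb{Z},\ 0\le c_j\le N\ \forall j\}$ with $s,r_1,\dots,r_k\in\mathbb{R}^d$ and $r_1,\dots,r_k$ linearly independent over $\mathbb{Z}$. For a Meyer set $\Lambda$, the group $\langle\Lambda\rangle$ generated by $\Lambda$ is a free $\mathbb{Z}$-module of finite rank, and $\operatorname{rank}(\Lambda):=\operatorname{rank}_{\mathbb{Z}}(\langle\Lambda\rangle)$. The number $\operatorname{ap-rank}(\Lambda)$ is the largest $k\in\mathbb{N}$ such that for all $N\in\mathbb{N}$ there exists an li-arithmetic progression of length $N$ and rank $k$ contained in $\Lambda$. *)

(* Defs.v *)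
From mathcomp Require Export all_boot all_order all_algebra.
From mathcomp Require Export all_classical all_reals all_analysis.
Export Order.TTheory GRing.Theory Num.Theory.
Export numFieldNormedType.Exports.

Set Implicit Arguments.
Unset Strict Implicit.
Unset Printing Implicit Defensive.

Local Open Scope classical_set_scope.
Local Open Scope ring_scope.

Section Zmodules.
Context {V : zmodType}.

(* Families indexed by 'I_k rather than sets: a repeated entry makes the family
   dependent, and the empty family (k = 0) is independent. *)
Definition zindependent k (r : 'I_k -> V) : Prop :=
  forall c : 'I_k -> int, \sum_i r i *~ c i = 0 -> forall i, c i = 0.

Definition zspan k (r : 'I_k -> V) : set V :=
  range (fun c : 'I_k -> int => \sum_i r i *~ c i).

Definition zbasis (G : set V) k (b : 'I_k -> V) : Prop :=
  zindependent b /\ G = zspan b.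

Definition zgenerated (A : set V) : set V :=
  smallest [set G | zmod_closed (mem G)] A.

(* Two finite bases of G have the same cardinality, so at most one k qualifies;
   [get] returns 0 when G is not free of finite rank. *)
Definition zrank (G : set V) : nat :=
  get [set k | exists b : 'I_k -> V, zbasis G b].

Definition li_progression (N k : nat) (A : set V) : Prop :=
  exists s (r : 'I_k -> V), zindependent r /\
    A = [set s + \sum_j r j *~ c j |
           c in [set c : 'I_k -> int | forall j, 0 <= c j <= N%:Z]].

Definition has_li_progressions (L : set V) (k : nat) : Prop :=
  forall N : nat, exists2 A, li_progression N k A & A `<=` L.

(* [get] returns 0 when there is no largest k. *)
Definition ap_rank (L : set V) : nat :=
  get [set k | has_li_progressions L k /\
               forall j, has_li_progressions L j -> (j <= k)%N].

Definition rank (L : set V) : nat := zrank (zgenerated L).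

End Zmodules.

Section Meyer.
Context {R : realType} {d : nat}.
Implicit Types L : set 'rV[R]_d.

(* The library norm on 'rV[R]_d is the sup norm, hence this Euclidean ball. *)
Definition eball (x : 'rV[R]_d) (r : R) : set 'rV[R]_d :=
  [set y | Num.sqrt (\sum_i (y 0 i - x 0 i) ^+ 2) < r].

Definition relatively_dense L : Prop :=
  exists2 r : R, 0 < r & forall x, eball x r `&` L !=set0.

Definition uniformly_discrete L : Prop :=
  exists2 r : R, 0 < r & forall x, is_subset1 (eball x r `&` L).

Definition meyer L : Prop :=
  relatively_dense L /\ uniformly_discrete [set x - y | x in L & y in L].

End Meyer.

Section CutAndProject.
Context {R : realType} {d m : nat}.
Implicit Types Lat : zmodClosed ('rV[R]_d * 'rV[R]_m)%type.

(* Being a subgroup is part of the type [zmodClosed]; discreteness says that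
   every point of Lat is isolated in Lat; co-compactness is compactness of the
   quotient group with its quotient topology. *)
Definition is_lattice Lat : Prop :=
  [set` Lat] `<=` isolated [set` Lat] /\
  compact [set: quotient_topology (Quotient.quot Lat)].

Definition cut_and_project_scheme Lat : Prop :=
  [/\ is_lattice Lat,
      {in Lat &, injective (fun p => p.1)} &
      dense [set p.2 | p in [set` Lat]]].

Definition curlywedge Lat (W : set 'rV[R]_m) : set 'rV[R]_d :=
  [set x | exists2 y, W y & (x, y) \in Lat].

End CutAndProject.

Definition fully_euclidean_model_set (R : realType) (d : nat)
    (M : set 'rV[R]_d) : Prop :=
  exists (m : nat) (Lat : zmodClosed ('rV[R]_d * 'rV[R]_m)%type)
    (W : set 'rV[R]_m),
    [/\ cut_and_project_scheme Lat, precompact W, W° !=set0 &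
        M = curlywedge Lat W].

Definition fully_euclidean_meyer (R : realType) (d : nat)
    (L : set 'rV[R]_d) : Prop :=
  relatively_dense L /\
  exists2 M, fully_euclidean_model_set M & L `<=` M.

(* Main.v *)
From HB Require Import structures.
Require Import Defs.
From mathcomp Require Import zify lra.

(** Let G be the group generated by the Meyer set L.  Since L is relatively
    dense, any two of its points are joined by a chain of points of L with
    bounded steps; the steps lie in L - L, which has finitely many elements of
    bounded norm, so G is finitely generated, hence free of some finite rank n
    (fg_zbasis).  The axes of a progression contained in L lie in G, so no
    progression in L has rank above n, and the theorem says that L is fully
    Euclidean exactly when it contains progressions of rank n of every length.

    From a model set to progressions (subset_model_set_progressions).  Let L be
    contained in the model set of W.  The second coordinates of the lattice are
    dense, so they can be crossed by arbitrarily small steps; hence the lattice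
    elements with small second coordinate generate the whole lattice, and n
    independent ones r_1, ..., r_n exist among them, as small as desired.
    Every point p of a large box spanned by the r_i then has a bounded second
    coordinate, and a lattice point over L close to the first coordinate of p
    differs from p by one of finitely many lattice vectors.  This finite
    colouring of the box has a monochromatic homothetic copy of {0..N}^n by
    Gallai's theorem (gallai), and translating this copy by its colour moves it
    into L.  The number of colours is fixed before the size of the box, and the
    r_i are chosen last, which is why Gallai's theorem is needed in a finitary
    form.

    From progressions to a model set (progressions_fully_euclidean).  Identify G
    with Z^n.  The coordinates of the points of L differ from a linear function
    of these points by a bounded amount (hom_almost_linear): this is where the
    uniform discreteness of L - L is used.  So R^n splits into a copy of R^d and
    a complement R^m, and the component of Z^n along R^m is bounded on L; this
    is a cut and project scheme with L inside a model set, except that the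
    projection of Z^n to R^m could fail to be dense.  A progression of rank n and
    length N in L has axes whose R^m-components have norm O(1/N), because N times
    an axis is a difference of two points of L.  Being n independent elements of
    Z^n, the axes span R^n, so their components span R^m; arbitrarily short
    vectors of the projected group thus span R^m, and rounding coefficients
    shows that this group is dense. *)

Set Implicit Arguments.
Unset Strict Implicit.
Unset Printing Implicit Defensive.

Local Open Scope classical_set_scope.
Local Open Scope ring_scope.

(** * Gallai's theorem by colour focusing *)

(** The pair q stands for the homothety v |-> q.1 + q.2 v. *)
Definition homothetic_mono (V : zmodType) (C : eqType) (f : V -> C)
    (vs : seq V) (q : V * nat) : bool :=
  (0 < q.2)%N && all (fun v => f (q.1 + v *+ q.2) == f q.1) vs.

(** The list T of homotheties is chosen before the colouring, so a colouring that
    carries information on a large enough finite set only is good enough. *)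
Definition gallai_for (V : zmodType) (vs : seq V) : Prop :=
  forall C : finType, exists T : seq (V * nat), forall f : V -> C,
    exists2 q, q \in T & homothetic_mono f vs q.

(** The homotheties in A send vs to monochromatic sets of pairwise distinct
    colours, and all of them send v to the same point p: whatever the colour
    of p, at most one of these sets can be completed by it. *)
Definition focused (V : zmodType) (C : eqType) (f : V -> C) (vs : seq V)
    (v p : V) (A : seq (V * nat)) : Prop :=
  uniq [seq f q.1 | q <- A] /\
  forall q, q \in A -> homothetic_mono f vs q /\ q.1 + v *+ q.2 = p.

(** Van der Waerden's induction.  Colour a translate s by the whole pattern that
    f shows on s + X: this is again a finite colouring, so the case of vs yields
    a homothety (s, e) along which the pattern repeats.  Increasing all the
    ratios of a focused family inside s + X by e keeps it focused, at the point
    s + p + e v, and the homothety (s + p, e) joins it with a new colour, unless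
    the colour of s + p already occurs; in that case the corresponding old
    homothety is monochromatic on v as well. *)
Lemma colour_focusing (V : zmodType) (v : V) (vs : seq V) (C : finType)
    (m : nat) :
  gallai_for vs ->
  exists (T : seq (V * nat)) (X : seq V), forall f : V -> C,
    (exists2 q, q \in T & homothetic_mono f (v :: vs) q) \/
    exists p A, [/\ size A = m, {subset A <= T}, p \in X, focused f vs v p A &
      forall q w, q \in A -> w \in 0 :: vs -> q.1 + w *+ q.2 \in X].
Proof.
move=> gal; elim: m => [|m [T [X IH]]].
  by exists [::], [:: 0] => f; right; exists 0, [::]; split; rewrite ?inE.
have [T' hT'] := gal {: (size X).-tuple C}.
pose T1 := [seq (s.1 + a.1, a.2) | s <- T', a <- T].
pose T2 := [seq (s.1 + a.1, (a.2 + s.2)%N) | s <- T', a <- T].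
pose T3 := [seq (s.1 + p, s.2) | s <- T', p <- X].
pose TT := T1 ++ T2 ++ T3.
have [X' memX'] : exists X' : seq V, forall q w,
    q \in TT -> w \in [:: 0, v & vs] -> q.1 + w *+ q.2 \in X'.
  exists (allpairs (fun q w => q.1 + w *+ q.2) TT [:: 0, v & vs]) => q w.
  exact: (@allpairs_f _ _ _ (fun q w => q.1 + w *+ q.2)).
exists TT, X' => f.
pose F b := [tuple f (b + tnth (in_tuple X) i) | i < size X].
have [[s e] sT' /andP[/= e0 /allP sF]] := hT' F.
have block w x : w \in vs -> x \in X -> f (s + w *+ e + x) = f (s + x).
  move=> wvs xX; have /eqP/(congr1 (fun t => tnth t)) := sF _ wvs.
  have iX : (index x X < size X)%N by rewrite index_mem.
  move/(congr1 (fun t => t (Ordinal iX))).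
  by rewrite !tnth_mktuple !(tnth_nth 0) /= nth_index.
have [[[a g] aT ag]|[p [A [sA AT pX [uA fA] AX]]]] := IH (fun x => f (s + x)).
  left; exists (s + a, g).
    by rewrite !mem_cat; apply/orP; left; apply/allpairsP; exists ((s, e), (a, g)).
  case/andP: ag => g0 /allP ag; rewrite /homothetic_mono g0; apply/allP => w wvs /=.
  by rewrite -addrA (eqP (ag _ wvs)).
have memT1 q : q \in A -> (s + q.1, q.2) \in TT.
  move=> /AT qT; rewrite !mem_cat; apply/orP; left.
  by apply/allpairsP; exists ((s, e), q).
have memT2 q : q \in A -> (s + q.1, (q.2 + e)%N) \in TT.
  move=> /AT qT; rewrite !mem_cat; apply/orP; right; apply/orP; left.
  by apply/allpairsP; exists ((s, e), q).
have memT3 : (s + p, e) \in TT.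
  rewrite !mem_cat; apply/orP; right; apply/orP; right.
  by apply/allpairsP; exists ((s, e), p).
have [/mapP[q qA fq]|nfp] := boolP (f (s + p) \in [seq f (s + q.1) | q <- A]).
  left; exists (s + q.1, q.2); first exact: memT1.
  have [/andP[q0 /allP qm] qp] := fA _ qA.
  rewrite /homothetic_mono q0 /= -addrA qp fq eqxx; apply/allP => w wvs /=.
  by rewrite -addrA (eqP (qm _ wvs)).
pose A' := (s + p, e) :: [seq (s + q.1, (q.2 + e)%N) | q <- A].
have A'T : {subset A' <= TT}.
  move=> q; rewrite inE => /predU1P[->//|/mapP[q' q'A ->]]; exact: memT2.
right; exists (s + p + v *+ e), A'; split => //.
- by rewrite /= size_map sA.
- by apply: (memX' (s + p, e)) => //; rewrite !inE eqxx orbT.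
- split.
    rewrite /= -map_comp /comp /=; apply/andP; split; first exact: nfp.
    exact: uA.
  move=> q; rewrite inE => /predU1P[->|/mapP[q' q'A ->]] /=.
    split=> //; rewrite /homothetic_mono e0 /=; apply/allP => w wvs.
    by rewrite addrAC block.
  have [/andP[q0 /allP qm] qp] := fA _ q'A.
  split; last by rewrite mulrnDr addrA -(addrA s) qp.
  rewrite /homothetic_mono /= addn_gt0 q0 /=; apply/allP => w wvs /=.
  rewrite mulrnDr addrA -(addrA s) addrAC block //; last first.
    by apply: AX => //; rewrite inE wvs orbT.
  by rewrite (eqP (qm _ wvs)).
- move=> q w qA' wv; apply: memX'; first exact: A'T.
  by move: wv; rewrite !inE => /orP[->//|->]; rewrite !orbT.
Qed.

(** A focused family cannot have more members than there are colours. *)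
Theorem gallai (V : zmodType) (vs : seq V) : gallai_for vs.
Proof.
elim: vs => [|v vs IH] C.
  by exists [:: (0, 1%N)] => f; exists (0, 1%N); rewrite ?inE.
have [T [X hT]] := @colour_focusing V v vs C #|C|.+1 IH.
exists T => f; case: (hT f) => // -[p [A [sA _ _ [uA _] _]]].
have := uniq_leq_size uA (s2 := enum C) (fun c _ => mem_enum _ c).
by rewrite size_map sA -cardE ltnn.
Qed.

(** * Finitely generated torsion-free groups *)

Section Combinations.
Context {V : zmodType}.
Implicit Types (A G : set V) (P : V -> Prop).

(** Coefficients as a row vector: passing to another family of generators is
    then a matrix product. *)
Definition zcomb k (r : 'I_k -> V) (c : 'rV[int]_k) : V :=
  \sum_i r i *~ c 0 i.

Lemma zcombB k (r : 'I_k -> V) c c' : zcomb r (c - c') = zcomb r c - zcomb r c'.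
Proof. by rewrite -sumrB; apply: eq_bigr => i _; rewrite !mxE mulrzBr. Qed.

Lemma zcomb0 k (r : 'I_k -> V) : zcomb r 0 = 0.
Proof. by have := zcombB r 0 0; rewrite !subrr. Qed.

Lemma zcombN k (r : 'I_k -> V) c : zcomb r (- c) = - zcomb r c.
Proof. by rewrite -[- c]sub0r zcombB zcomb0 sub0r. Qed.

Lemma zcombD k (r : 'I_k -> V) c c' : zcomb r (c + c') = zcomb r c + zcomb r c'.
Proof. by rewrite -{1}(opprK c') zcombB zcombN opprK. Qed.

Lemma zcombZ k (r : 'I_k -> V) a c : zcomb r (a *: c) = zcomb r c *~ a.
Proof.
by rewrite mulrz_suml; apply: eq_bigr => i _; rewrite mxE mulrC mulrzA.
Qed.

Lemma zcomb_delta k (r : 'I_k -> V) i : zcomb r (delta_mx 0 i) = r i.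
Proof.
rewrite /zcomb (bigD1 i) //= mxE !eqxx /= mulr1z big1 ?addr0 // => j /negbTE ji.
by rewrite mxE eqxx ji.
Qed.

Lemma zcomb_mulmx k l (r : 'I_k -> V) (M : 'M[int]_(l, k)) c :
  zcomb (fun i => zcomb r (row i M)) c = zcomb r (c *m M).
Proof.
rewrite /zcomb; under eq_bigr => i _ do rewrite mulrz_suml.
rewrite exchange_big /=; apply: eq_bigr => j _.
rewrite mxE mulrz_sumr; apply: eq_bigr => i _.
by rewrite mxE -mulrzA mulrC.
Qed.

Lemma zindependentP k (r : 'I_k -> V) :
  zindependent r <-> forall c, zcomb r c = 0 -> c = 0.
Proof.
split=> ri c.
  by move=> /(ri (fun i => c 0 i)) c0; apply/rowP => i; rewrite c0 mxE.
move=> rc i; have := ri (\row_i c i).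
rewrite /zcomb; under eq_bigr => j _ do rewrite mxE.
by move=> /(_ rc) /rowP /(_ i); rewrite !mxE.
Qed.

Lemma zspanP k (r : 'I_k -> V) x : zspan r x <-> exists c, x = zcomb r c.
Proof.
split=> [[c _ <-]|[c ->]].
  by exists (\row_i c i); apply: eq_bigr => i _; rewrite mxE.
by exists (fun i => c 0 i).
Qed.

Lemma zgenerated_ind A P :
    P 0 -> (forall x y, P x -> P y -> P (x - y)) -> (forall x, A x -> P x) ->
  forall x, zgenerated A x -> P x.
Proof.
move=> P0 PB PA x /(_ [set x | P x]); apply; split=> [|y /PA//].
split=> [|y z]; first by rewrite inE.
by rewrite !inE; apply: PB.
Qed.

Lemma sub_zgenerated A : A `<=` zgenerated A.
Proof. by move=> x Ax G [_]; apply. Qed.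

Lemma zgenerated0 A : zgenerated A 0.
Proof. by move=> G [[G0 _] _]; rewrite inE in G0. Qed.

Lemma zgeneratedB A x y : zgenerated A x -> zgenerated A y -> zgenerated A (x - y).
Proof.
move=> Ax Ay G GA; have [[_ GB] _] := GA.
by have := GB x y; rewrite !inE; apply; [apply: Ax | apply: Ay].
Qed.

Lemma zspanB k (r : 'I_k -> V) x y : zspan r x -> zspan r y -> zspan r (x - y).
Proof.
by move=> /zspanP[c ->] /zspanP[e ->]; apply/zspanP; exists (c - e); rewrite zcombB.
Qed.

Lemma zspan_ind k (r : 'I_k -> V) P :
    P 0 -> (forall x y, P x -> P y -> P (x - y)) -> (forall i, P (r i)) ->
  forall x, zspan r x -> P x.
Proof.
move=> P0 PB Pr x [c _ <-].
have PN y : P y -> P (- y) by move=> ?; rewrite -sub0r; apply: PB.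
have PD y z : P y -> P z -> P (y + z).
  by move=> ? ?; rewrite -(opprK z); apply: PB => //; apply: PN.
have Pn y n : P y -> P (y *+ n).
  by move=> Py; elim: n => [|n IH]; rewrite ?mulr0n // mulrS; apply: PD.
by apply: big_ind => // i _; case: (c i) => n;
   [apply: Pn | rewrite NegzE mulrNz; apply: PN; apply: Pn].
Qed.

Lemma zspan_mem k (r : 'I_k -> V) i : zspan r (r i).
Proof. by apply/zspanP; exists (delta_mx 0 i); rewrite zcomb_delta. Qed.

Hypothesis tf : forall (x : V) (n : int), n != 0 -> x *~ n = 0 -> x = 0.

(** The Smith normal form of a relation c between the generators is a change of
    generators that turns c into d times the first coordinate.  As there is no
    torsion, the first new generator vanishes and can be dropped. *)
Lemma fg_zbasis k (r : 'I_k -> V) :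
  exists n (b : 'I_n -> V), zbasis (zspan r) b.
Proof.
elim: k r => [|k IH] r.
  by exists 0%N, r; split=> //; move=> c _ [].
have [rI|] := pselect (zindependent r); first by exists k.+1, r.
move=> /zindependentP /existsNP[c] /not_implyP[rc0 /eqP c0].
have [L uL [U uU [e _ cE]]] := int_Smith_normal_form c.
pose D : 'rV[int]_k.+1 := \matrix_(i, j) (e`_i *+ (i == j :> nat)).
pose s i := zcomb r (row i U).
have sD : zcomb s D = 0.
  have DE : D *m U = invmx L *m c by rewrite cE -mulmxA mulKmx.
  by rewrite zcomb_mulmx DE [invmx L]mx11_scalar mul_scalar_mx zcombZ rc0 mul0rz.
have e0 : e`_0 != 0.
  apply: contra_neq c0 => e0; rewrite cE.
  suff -> : (\matrix_(i, j) (e`_i *+ (i == j :> nat)) : 'rV[int]_k.+1) = 0.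
    by rewrite mulmx0 mul0mx.
  by apply/matrixP => i j; rewrite !mxE ord1 e0 mul0rn.
have s0 : s ord0 = 0.
  apply: (tf e0); move: sD; rewrite /zcomb big_ord_recl big1 ?addr0 => [|i _].
    by rewrite mxE.
  by rewrite mxE mulr0n mulr0z.
have [n [b [bI bE]]] := IH (s \o lift ord0).
exists n, b; split=> //; rewrite -bE; apply/seteqP; split=> x.
  apply: zspan_ind => [|y z|i].
  - by apply/zspanP; exists 0; rewrite zcomb0.
  - exact: zspanB.
  have -> : r i = zcomb s (row i (invmx U)).
    by rewrite zcomb_mulmx -row_mul mulVmx // row1 zcomb_delta.
  apply/zspanP; exists (\row_j row i (invmx U) 0 (lift ord0 j)).
  rewrite /zcomb big_ord_recl s0 mul0rz add0r.
  by apply: eq_bigr => j _; rewrite !mxE.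
apply: zspan_ind => [|y z|i].
- by apply/zspanP; exists 0; rewrite zcomb0.
- exact: zspanB.
by apply/zspanP; exists (row (lift ord0 i) U).
Qed.

(** Padding with zero columns makes the matrix square and singular. *)
Lemma int_left_kernel k n (M : 'M[int]_(k, n)) :
  (n < k)%N -> exists2 v : 'rV[int]_k, v != 0 & v *m M = 0.
Proof.
move=> nk; have {nk} kE : (k = n + (k - n).-1.+1)%N by lia.
move: (k - n).-1 kE => l kE; subst k.
have /det0P[v v0] : \det (row_mx M (0 : 'M[int]_(n + l.+1, l.+1))) == 0.
  rewrite -det_tr; apply/det0P; exists (row_mx 0 (const_mx 1)).
    apply: contraTneq isT => /(congr1 rsubmx); rewrite row_mxKr linear0.
    by move=> /rowP /(_ ord0); rewrite !mxE.
  by rewrite tr_row_mx mul_row_col mul0mx trmx0 mulmx0 addr0.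
by rewrite mul_mx_row => /(congr1 lsubmx); rewrite row_mxKl linear0; exists v.
Qed.

Lemma zbasis_coords G n (b : 'I_n -> V) k (r : 'I_k -> V) :
    zbasis G b -> (forall i, G (r i)) ->
  exists M : 'M[int]_(k, n), forall i, r i = zcomb b (row i M).
Proof.
move=> [_ ->] Gr; have /choice[f fP] : forall i, exists c, r i = zcomb b c.
  by move=> i; apply/zspanP.
by exists (\matrix_i f i) => i; rewrite rowK.
Qed.

Lemma zindependent_leq G n (b : 'I_n -> V) k (r : 'I_k -> V) :
  zbasis G b -> zindependent r -> (forall i, G (r i)) -> (k <= n)%N.
Proof.
move=> bG /zindependentP rI /(zbasis_coords bG)[M rM]; rewrite leqNgt.
apply/negP => /(int_left_kernel M)[v /eqP v0 vM]; apply: v0; apply: rI.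
rewrite (_ : r = fun i => zcomb b (row i M)); last exact/funext.
by rewrite zcomb_mulmx vM zcomb0.
Qed.

(** A largest independent family r in A of size k <= n: every element of A has a
    nonzero multiple in the span of r, hence so does every element of the group
    generated by A.  Suitable multiples of the x i are then n independent
    elements of a group of rank k, so k = n. *)
Lemma zindependent_in_generators A n (x : 'I_n -> V) :
    zindependent x -> (forall i, zgenerated A (x i)) ->
  exists r : 'I_n -> V, zindependent r /\ forall i, A (r i).
Proof.
move=> xI Ax.
pose good k := exists r : 'I_k -> V, zindependent r /\ forall i, A (r i).
have [k /andP[/asboolP[r [rI Ar]] kn] kmax] :
    exists2 k, `[< good k >] && (k <= n)%N &
      forall l, `[< good l >] && (l <= n)%N -> (l <= k)%N.
  have ex0 : exists k, `[< good k >] && (k <= n)%N.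
    exists 0%N; rewrite andbT; apply/asboolP.
    by exists (fun=> 0); split=> [c _|] [].
  have bnd l : `[< good l >] && (l <= n)%N -> (l <= n)%N by case/andP.
  by case: (ex_maxnP ex0 bnd) => k; exists k.
have [nk|kn'] := leqP n k.
  by have -> : n = k by [lia]; exists r.
exfalso.
pose tors y := exists2 N : int, N != 0 & zspan r (y *~ N).
have torsA y : A y -> tors y.
  move=> Ay; pose s (i : 'I_k.+1) := if unlift ord0 i is Some j then r j else y.
  have /zindependentP/existsNP[c /not_implyP[sc0 /eqP c0]] : ~ zindependent s.
    move=> sI; have /kmax : `[< good k.+1 >] && (k < n)%N.
      rewrite kn' andbT; apply/asboolP; exists s; split=> // i.
      by rewrite /s; case: unliftP.
    by rewrite ltnn.
  have sE : y *~ c 0 0 + zcomb r (\row_j c 0 (lift ord0 j)) = 0.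
    rewrite -[RHS]sc0 /zcomb big_ord_recl {1}/s unlift_none; congr (_ + _).
    by apply: eq_bigr => j _; rewrite mxE /s liftK.
  exists (c 0 0).
    apply: contra_neq c0 => c00; move: sE; rewrite c00 mulr0z add0r.
    move/zindependentP : rI => /[apply] /rowP cl; apply/rowP => j.
    rewrite mxE; case: (unliftP ord0 j) => [i ->|->//].
    by have := cl i; rewrite !mxE.
  apply/zspanP; exists (- \row_j c 0 (lift ord0 j)); rewrite zcombN.
  by apply/eqP; rewrite -addr_eq0 sE.
have torsx i : tors (x i).
  apply: (zgenerated_ind (A := A) (P := tors)) => // [|y z [N N0 Ny] [M M0 Mz]].
    by exists 1 => //; rewrite mulr1z; apply/zspanP; exists 0; rewrite zcomb0.
  exists (N * M); first by rewrite mulf_neq0.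
  move: Ny Mz => /zspanP[c cE] /zspanP[e eE].
  apply/zspanP; exists (M *: c - N *: e).
  by rewrite zcombB !zcombZ -cE -eE -!mulrzA mulrzBl (mulrC M).
have /choice[N NP] : forall i, exists N : int, N != 0 /\ zspan r (x i *~ N).
  by move=> i; have [N ? ?] := torsx i; exists N.
suff : (n <= k)%N by rewrite leqNgt kn'.
apply: (@zindependent_leq (zspan r) k r n (fun i => x i *~ N i)) => //; last first.
  by move=> i; have [] := NP i.
move=> c cx0 i; have := xI (fun i => N i * c i) _ i.
under eq_bigr do rewrite mulrzA.
by move=> /(_ cx0) /eqP; rewrite mulf_eq0 (negbTE (NP i).1) => /eqP.
Qed.

End Combinations.

(** * Separated and relatively dense sets *)

Section SupNorm.
Context {R : realType}.

Lemma coord_le_norm n (x : 'rV[R]_n) i : `|x 0 i| <= `|x|.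
Proof.
rewrite [leRHS]/Num.norm /= mx_normrE.
by apply: (@le_bigmax _ _ _ 0 (fun ij : 'I_1 * 'I_n => `|x ij.1 ij.2|) (0, i)).
Qed.

Lemma norm_le_coord n (x : 'rV[R]_n) B :
  0 <= B -> (forall i, `|x 0 i| <= B) -> `|x| <= B.
Proof.
move=> B0 xB; rewrite [leLHS]/Num.norm /= mx_normrE; apply/bigmax_leP.
by split=> // -[i j] _; rewrite /= ord1.
Qed.

Lemma norm_lt_coord n (x : 'rV[R]_n) B :
  0 < B -> (forall i, `|x 0 i| < B) -> `|x| < B.
Proof.
move=> B0 xB; rewrite [ltLHS]/Num.norm /= mx_normrE; apply/bigmax_ltP.
by split=> // -[i j] _; rewrite /= ord1.
Qed.

Lemma norm_mulmx_le n m (A : 'M[R]_(n, m)) :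
  exists2 C, 0 <= C & forall x : 'rV_n, `|x *m A| <= C * `|x|.
Proof.
have C0 : 0 <= \sum_j \sum_i `|A i j| by apply: sumr_ge0 => j _; apply: sumr_ge0.
exists (\sum_j \sum_i `|A i j|) => // x.
apply: norm_le_coord => [|j]; first by rewrite mulr_ge0.
rewrite mxE (le_trans (ler_norm_sum _ _ _)) //.
have : \sum_i `|x 0 i * A i j| <= (\sum_i `|A i j|) * `|x|.
  rewrite mulr_suml; apply: ler_sum => i _.
  by rewrite normrM mulrC ler_wpM2l // coord_le_norm.
move=> /le_trans; apply; rewrite ler_wpM2r //.
by rewrite [leRHS](bigD1 j) //= lerDl sumr_ge0 // => k _; apply: sumr_ge0.
Qed.

Lemma rV_torsion_free n (x : 'rV[R]_n) (k : int) : k != 0 -> x *~ k = 0 -> x = 0.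
Proof.
move=> k0; rewrite -scaler_int => /eqP.
by rewrite scaler_eq0 intr_eq0 (negbTE k0) => /eqP.
Qed.

(** Relative density and, with separated, uniform discreteness, for the sup norm;
    it is equivalent to the Euclidean one. *)
Definition dense_within n (L : set 'rV[R]_n) (rho : R) : Prop :=
  0 < rho /\ forall x, exists2 y, L y & `|y - x| < rho.

Definition separated n (D : set 'rV[R]_n) (r : R) : Prop :=
  0 < r /\ forall u v, D u -> D v -> `|u - v| < r -> u = v.

Lemma relatively_dense_within n (L : set 'rV[R]_n) :
  relatively_dense L -> exists rho, dense_within L rho.
Proof.
move=> [r r0 rL]; exists r; split=> // x; have [y [xy Ly]] := rL x.
exists y => //; apply: norm_lt_coord => // i; rewrite !mxE.
apply: le_lt_trans xy; rewrite -sqrtr_sqr ler_wsqrtr //.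
rewrite (bigD1 i) //= lerDl sumr_ge0 // => j _; exact: sqr_ge0.
Qed.

Lemma uniformly_discrete_separated n (D : set 'rV[R]_n) :
  uniformly_discrete D -> exists r, separated D r.
Proof.
move=> [r r0 rD]; exists (r / n.+1%:R); split=> [|u v Du Dv uv].
  by rewrite divr_gt0 // ltr0n.
have r1 : 0 <= r / n.+1%:R by rewrite divr_ge0 // ltW // ltr0n.
apply: (rD u); split=> //; rewrite /eball /=.
  by rewrite big1 ?sqrtr0 // => i _; rewrite subrr expr0n.
apply: (@le_lt_trans _ _ (Num.sqrt (n%:R * (r / n.+1%:R) ^+ 2))).
  rewrite ler_wsqrtr // -[n in n%:R]card_ord mulr_natl -sumr_const ler_sum // => i _.
  rewrite -[leLHS]real_normK ?num_real // lerXn2r ?nnegrE //.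
  rewrite distrC (le_trans _ (ltW uv)) //.
  by have := coord_le_norm (u - v) i; rewrite !mxE.
rewrite -[ltRHS](ger0_norm (ltW r0)) -sqrtr_sqr ltr_sqrt ?exprn_gt0 //.
rewrite exprMn mulrCA -[ltRHS]mulr1 ltr_pM2l ?exprn_gt0 //.
rewrite exprVn -ltr_pdivlMr ?invr_gt0 ?exprn_gt0 ?ltr0n // invrK mul1r.
by rewrite -natrX ltr_nat; nia.
Qed.

(** Rounding coordinates to multiples of r is injective on an r-separated set,
    and the number of cells that meet a ball depends on its radius only.  The
    uniformity in the centre c is essential for hom_bounded_on_triples. *)
Lemma packing (T : Type) n (k : T -> 'rV[R]_n) (S : set T) (r rho : R) :
    0 < r -> (forall u v, S u -> S v -> `|k u - k v| < r -> u = v) ->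
  exists K : finType, forall c, exists g : T -> K, forall u v,
    S u -> S v -> `|k u - c| < rho -> `|k v - c| < rho -> g u = g v -> u = v.
Proof.
move=> r0 Sr; pose m := Num.truncn (2 * rho / r).
exists {ffun 'I_n -> 'I_m.+1} => c.
pose t u i := ((k u - c) 0 i + rho) / r.
exists (fun u => [ffun i => inord (Num.truncn (t u i))]) => u v Su Sv uc vc guv.
have tm w : `|k w - c| < rho -> forall i, 0 <= t w i /\ (Num.truncn (t w i) < m.+1)%N.
  move=> wc i; have := le_lt_trans (coord_le_norm _ i) wc.
  rewrite ltr_norml => /andP[wl wr]; have t0 : 0 <= t w i.
    by rewrite divr_ge0 ?(ltW r0) //; lra.
  split=> //; rewrite ltnS le_truncn // ler_pM2r ?invr_gt0 //; lra.
apply: Sr => //; apply: norm_lt_coord => // i.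
have /(congr1 val) := congr1 (fun h : {ffun _} => h i) guv.
have [[tu0 tum] [tv0 tvm]] := (tm _ uc i, tm _ vc i).
rewrite !ffunE /= !inordK // => tuv.
have := (truncn_itv tu0, truncn_itv tv0); rewrite tuv.
rewrite -natr1; move: (_%:R) => q [/andP[u1 u2] /andP[v1 v2]].
have -> : (k u - k v) 0 i = (t u i - t v i) * r.
  rewrite mulrBl !divfK ?lt0r_neq0 // !mxE; lra.
rewrite normrM (gtr0_norm r0) -[ltRHS]mul1r ltr_pM2r // ltr_norml; lra.
Qed.

Lemma packing_bound n (D : set 'rV[R]_n) (r rho : R) : separated D r ->
  exists N, forall c (s : seq 'rV[R]_n), uniq s ->
    (forall u, u \in s -> D u /\ `|u - c| < rho) -> (size s <= N)%N.
Proof.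
move=> [r0 Dr]; have [K gK] := @packing _ _ id D r rho r0 Dr.
exists #|K| => c s us sD; have [g gI] := gK c.
have um : uniq (map g s).
  rewrite map_inj_in_uniq // => u v /sD[Du uc] /sD[Dv vc]; exact: gI.
have := uniq_leq_size um (s2 := enum K) (fun c _ => mem_enum _ c).
by rewrite size_map -cardE.
Qed.

Lemma bounded_part_finite (T : eqType) n (k : T -> 'rV[R]_n) (S : set T)
    (r rho : R) :
    0 < r -> (forall u v, S u -> S v -> `|k u - k v| < r -> u = v) ->
  exists s : seq T, forall u, u \in s <-> S u /\ `|k u| < rho.
Proof.
move=> r0 Sr; have [K /(_ 0)[g gI]] := packing rho r0 Sr.
pose pre y u := [/\ S u, `|k u| < rho & g u = y].
pose sel y : option T :=
  if pselect (exists u, pre y u) is left e then Some (projT1 (cid e)) else None.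
exists (pmap sel (enum K)) => u; split=> [|[Su ur]].
  rewrite mem_pmap => /mapP[y _]; rewrite /sel; case: pselect => //= e [->].
  by case: cid => v /= [].
rewrite mem_pmap; apply/mapP; exists (g u); first by rewrite mem_enum.
rewrite /sel; case: pselect => [e|[]]; last by exists u.
case: cid => v /= [Sv vr gv]; congr Some.
by apply: gI => //; rewrite subr0.
Qed.

Lemma seq_bounded (T : eqType) (s : seq T) (f : T -> R) :
  exists2 C, 0 <= C & forall u, u \in s -> `|f u| <= C.
Proof.
exists (\sum_(u <- s) `|f u|) => [|u us]; first exact: sumr_ge0.
by rewrite (big_rem u) //= lerDl sumr_ge0.
Qed.

(** Approximating points of the segment from y to x within rho, at distance at
    most rho from each other, gives a chain in L with steps below 3 rho. *)
Lemma chain_ind n (L : set 'rV[R]_n) rho (P : 'rV[R]_n -> Prop) y :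
    dense_within L rho -> L y -> P y ->
    (forall u v, L u -> L v -> `|u - v| < 3 * rho -> P u -> P v) ->
  forall x, L x -> P x.
Proof.
move=> [rho0 Lrho] Ly Py step x Lx.
suff H k z : `|z - y| <= k%:R * rho -> forall x, L x -> `|x - z| < rho -> P x.
  have [k kx] : exists k : nat, `|x - y| <= k%:R * rho.
    have q0 : 0 <= `|x - y| / rho by rewrite divr_ge0 // ltW.
    exists (Num.truncn (`|x - y| / rho)).+1; rewrite -ler_pdivrMr //.
    by have /andP[_ /ltW] := truncn_itv q0.
  by apply: (H k x) => //; rewrite subrr normr0.
elim: k z => [|k IH] z zy w Lw wz.
  move: zy; rewrite mul0r normr_le0 subr_eq0 => /eqP zy.
  by apply: (step y) => //; rewrite -zy distrC; lra.
pose q : R := k%:R / k.+1%:R.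
have q1 : 1 - q = k.+1%:R^-1.
  have k1 : k.+1%:R != 0 :> R by rewrite pnatr_eq0.
  by apply: (mulIf k1); rewrite mulrBl mul1r divfK // mulVf // -natr1; lra.
pose z' := y + q *: (z - y); have [w' Lw' w'z'] := Lrho z'.
have Pw' : P w'.
  apply: (IH z') => //; rewrite /z' addrAC subrr add0r normrZ ger0_norm ?divr_ge0 //.
  by rewrite /q mulrAC ler_pdivrMr ?ltr0n // -!mulrA ler_wpM2l // mulrC.
apply: (step w') => //.
have zz' : `|z' - z| <= rho.
  have -> : z' - z = - ((1 - q) *: (z - y)).
    by apply/rowP => i; rewrite !mxE; lra.
  by rewrite normrN normrZ q1 ger0_norm ?invr_ge0 // ler_pdivrMl ?ltr0n.
have -> : w' - w = (w' - z') + (z' - z) - (w - z).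
  by apply/rowP => i; rewrite !mxE; lra.
have := ler_normB ((w' - z') + (z' - z)) (w - z).
have := ler_normD (w' - z') (z' - z); lra.
Qed.

(** The generators are the steps of chains, together with the starting point. *)
Lemma meyer_finitely_generated n (L : set 'rV[R]_n) : meyer L ->
  exists k (b : 'I_k -> 'rV[R]_n), zgenerated L = zspan b.
Proof.
move=> [/relatively_dense_within[rho Lrho] /uniformly_discrete_separated[r [r0 Dr]]].
have [F FP] := @bounded_part_finite _ _ id _ r (3 * rho) r0 Dr.
have [x0 Lx0 _] := Lrho.2 0.
pose s := x0 :: F; exists (size s), (fun i => s`_i).
have span_s u : u \in s -> zspan (fun i : 'I_(size s) => s`_i) u.
  move=> us; have iX : (index u s < size s)%N by rewrite index_mem.
  by have := zspan_mem (fun i : 'I_(size s) => s`_i) (Ordinal iX); rewrite /= nth_index.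
have span0 : zspan (fun i : 'I_(size s) => s`_i) 0.
  by apply/zspanP; exists 0; rewrite zcomb0.
apply/seteqP; split=> x.
  apply: zgenerated_ind => // [u v|]; first exact: zspanB.
  apply: (@chain_ind _ _ _ (zspan (fun i : 'I_(size s) => s`_i)) _ Lrho Lx0).
    by apply: span_s; rewrite inE eqxx.
  move=> u v Lu Lv uv Pu; rewrite -(subKr u v); apply: zspanB => //.
  apply: span_s; rewrite inE; apply/orP; right; apply/FP.
  by split=> //; exists u => //; exists v.
apply: zspan_ind => [|u v|i]; first exact: zgenerated0.
  exact: zgeneratedB.
have := mem_nth 0 (ltn_ord i); rewrite {1}/s inE => /predU1P[->|].
  exact: sub_zgenerated.
by move=> /FP[[u Lu [v Lv <-]] _]; apply: zgeneratedB; apply: sub_zgenerated.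
Qed.

Lemma meyer_zbasis n (L : set 'rV[R]_n) : meyer L ->
  exists b : 'I_(rank L) -> 'rV[R]_n, zbasis (zgenerated L) b.
Proof.
move=> /meyer_finitely_generated[k [s sE]].
have [m [b bP]] := fg_zbasis (@rV_torsion_free n) s.
apply: (@getPex _ [set k | exists b : 'I_k -> 'rV[R]_n, zbasis (zgenerated L) b]).
by exists m, b; rewrite sE.
Qed.

End SupNorm.

(** * Homomorphisms on a Meyer set are almost linear *)

Section AlmostLinear.
Context {R : realType}.

(** The slope a is the supremum of (h n - C) / n over the integers n >= 1.
    Comparing the value at n m computed in two ways shows that each of these is
    at most (h m + C) / m, so h stays within C of a n at the natural numbers; the
    fractional part is absorbed by the bound B, and negative numbers by
    quasi-additivity. *)
Lemma quasi_additive_real (h : R -> R) (C B : R) :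
    (forall s t, `|h (s + t) - h s - h t| <= C) ->
    (forall t, `|t| <= 1 -> `|h t| <= B) ->
  exists a C', forall t, `|h t - a * t| <= C'.
Proof.
move=> hC hB.
have C0 : 0 <= C by apply: le_trans (hC 0 0).
have hnat n t : `|h (t *+ n.+1) - h t *+ n.+1| <= C *+ n.
  elim: n => [|n IH]; first by rewrite subrr normr0.
  have := hC t (t *+ n.+1); rewrite -mulrS.
  have -> : h (t *+ n.+2) - h t *+ n.+2 =
      (h (t *+ n.+2) - h t - h (t *+ n.+1)) + (h (t *+ n.+1) - h t *+ n.+1).
    by rewrite (mulrS (h t)); lra.
  move=> hCn; rewrite [C *+ _]mulrS (le_trans (ler_normD _ _)) // lerD //.
(* Both sides are compared with the value at the product of n+1 and m+1. *)
have cross n m : m.+1%:R * (h n.+1%:R - C) <= n.+1%:R * (h m.+1%:R + C).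
  have := hnat m n.+1%:R; have := hnat n m.+1%:R.
  rewrite -!mulrnA mulnC => hn hm.
  move: hn hm; rewrite -[h _ *+ n.+1]mulr_natl -[h _ *+ m.+1]mulr_natl.
  rewrite -[C *+ n]mulr_natl -[C *+ m]mulr_natl !ler_norml -!natr1.
  by move=> /andP[n1 n2] /andP[m1 m2]; nra.
pose E := [set (h n.+1%:R - C) / n.+1%:R | n in setT].
have Eub m : ubound E ((h m.+1%:R + C) / m.+1%:R).
  move=> _ [n _ <-]; rewrite ler_pdivrMr ?ltr0n // mulrAC ler_pdivlMr ?ltr0n //.
  by rewrite mulrC (mulrC (_ + _)) cross.
have Esup : has_sup E.
  split; first by exists ((h 1%:R - C) / 1%:R); exists 0%N.
  by exists ((h 1%:R + C) / 1%:R); apply: Eub.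
pose a := sup E.
have an n : `|h n%:R - a * n%:R| <= C.
  case: n => [|n].
    have := hC 0 0; rewrite addr0 subrr sub0r normrN mulr0 subr0.
    by [].
  have lo : (h n.+1%:R - C) / n.+1%:R <= a.
    by apply: ub_le_sup; [case: Esup | exists n].
  have up : a <= (h n.+1%:R + C) / n.+1%:R by apply: ge_sup => //; case: Esup.
  move: lo up; rewrite ler_pdivrMr ?ltr0n // ler_pdivlMr ?ltr0n // => lo up.
  by rewrite ler_norml; lra.
have apos t : 0 <= t -> `|h t - a * t| <= C + C + B + `|a|.
  move=> /truncn_itv; set n := Num.truncn t; rewrite -natr1 => /andP[t1 t2].
  have hf : `|h (t - n%:R)| <= B by apply: hB; rewrite ler_norml; lra.
  have := hC n%:R (t - n%:R); rewrite (addrC n%:R) subrK.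
  have af : `|a * (t - n%:R)| <= `|a|.
    by rewrite normrM -[leRHS]mulr1 ler_wpM2l // ler_norml; lra.
  move: hf af (an n); rewrite !ler_norml; lra.
exists a, (C + C + B + `|a| + C + `|h 0|) => t.
have [t0|t0] := leP 0 t; first by have := apos _ t0; have := normr_ge0 (h 0); lra.
have := hC t (- t); have := apos (- t); rewrite subrr mulrN opprK oppr_ge0 => /(_ (ltW t0)).
have := lexx `|h 0|; rewrite !ler_norml; lra.
Qed.

Lemma quasi_additive_sum n (g : 'rV[R]_n -> R) (C : R) I (s : seq I)
    (v : I -> 'rV[R]_n) :
    (forall u v, `|g (u + v) - g u - g v| <= C) ->
  `|g (\sum_(i <- s) v i) - \sum_(i <- s) g (v i)| <= `|g 0| + C *+ size s.
Proof.
move=> gC; elim: s => [|i s IH]; first by rewrite !big_nil subr0 addr0.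
rewrite !big_cons /= mulrSr addrA.
have := gC (v i) (\sum_(i <- s) v i); move: IH.
move: (\sum_(i <- s) v i) (\sum_(i <- s) g (v i)) => w W.
rewrite !ler_norml; lra.
Qed.

Lemma quasi_additive_linear n (g : 'rV[R]_n -> R) (C B : R) :
    (forall u v, `|g (u + v) - g u - g v| <= C) ->
    (forall v, `|v| <= 1 -> `|g v| <= B) ->
  exists (a : 'cV[R]_n) (C' : R), forall v, `|g v - (v *m a) 0 0| <= C'.
Proof.
move=> gC gB.
have /choice[a /choice[Ca aP]] i : exists a C', forall t,
    `|g (t *: delta_mx 0 i) - a * t| <= C'.
  apply: (@quasi_additive_real _ C B) => [s t|t t1]; first by rewrite scalerDl.
  apply: gB; apply: norm_le_coord => // j; rewrite !mxE /=.
  by case: eqP => _; rewrite ?mulr1 ?mulr0 ?normr0.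
exists (\col_i a i), (`|g 0| + C *+ size (index_enum 'I_n) + \sum_i Ca i) => v.
have := quasi_additive_sum (index_enum 'I_n) (fun i => v 0 i *: delta_mx 0 i) gC.
rewrite -row_sum_delta.
have : `|\sum_i g (v 0 i *: delta_mx 0 i) - (v *m \col_i a i) 0 0| <= \sum_i Ca i.
  rewrite mxE -sumrB (le_trans (ler_norm_sum _ _ _)) // ler_sum // => i _.
  by rewrite mxE mulrC aP.
move: (\sum_i g _) => W; rewrite !ler_norml; lra.
Qed.

Context {n : nat} (L : set 'rV[R]_n) (chi : 'rV[R]_n -> R) (rho r : R).
Hypothesis Lrho : dense_within L rho.
Hypothesis Dr : separated [set x - y | x in L & y in L] r.
Hypothesis chiB : forall x y, zgenerated L x -> zgenerated L y ->
  chi (x - y) = chi x - chi y.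

Let genL x : L x -> zgenerated L x. Proof. exact: sub_zgenerated. Qed.

Lemma hom_bounded_on_differences (s : R) :
  exists2 C, 0 <= C & forall x y, L x -> L y -> `|x - y| < s -> `|chi (x - y)| <= C.
Proof.
have [F FP] := @bounded_part_finite _ _ _ id _ r s Dr.1 Dr.2.
have [C C0 CF] := seq_bounded F chi; exists C => // x y Lx Ly xy.
by apply: CF; apply/FP; split=> //; exists x => //; exists y.
Qed.

Lemma path_variation (T : eqType) (f : T -> R) (c : R) x (p : seq T) :
  path (fun u v => `|f u - f v| <= c) x p ->
  `|f x - f (last x p)| <= c *+ size p.
Proof.
elim: p x => [|y p IH] x /=; first by rewrite subrr normr0.
move=> /andP[xy /IH]; move: xy; rewrite mulrS; move: (_ *+ _) => q.
move: (f (last y p)) => l; rewrite !ler_norml; lra.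
Qed.

(** The elements x - y - l of bounded norm need not be finitely many a priori,
    so chi has to be bounded by other means.  Walk y along a chain to a point y0
    near 0, keeping x close to y + l: then w = x - y - l changes by a sum of two
    short elements of L - L, hence chi w changes by at most a constant.  All the
    visited w lie in the r-separated set (L - L) - l within a ball of fixed
    radius, so there are at most N of them, N independent of l; removing the
    loops from the walk bounds its total variation.  At the end of the walk,
    chi w is bounded because x - l is a short element of L - L. *)
Lemma hom_bounded_on_triples (s : R) :
  exists2 C, 0 <= C & forall x y l, L x -> L y -> L l ->
    `|x - y - l| < s -> `|chi (x - y - l)| <= C.
Proof.
wlog srho : s / rho <= s.
  have smax : rho <= Num.max s rho by rewrite le_max lexx orbT.
  move=> H; have [C C0 HC] := H _ smax.
  by exists C => // x y l Lx Ly Ll xyl; apply: HC => //; rewrite lt_max xyl.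
have rho0 := Lrho.1.
pose step := s + s + 3 * rho + (s + rho).
have [C1 C10 C1P] := hom_bounded_on_differences step.
have [N NP] := packing_bound s Dr.
have [y0 Ly0 y0rho] := Lrho.2 0; rewrite subr0 in y0rho.
exists (C1 + `|chi y0| + (C1 + C1) *+ N) => [|x y l Lx Ly Ll].
  by rewrite addr_ge0 ?mulrn_wge0 // addr_ge0.
pose D := [set x - y | x in L & y in L].
pose e w w' := `|chi w - chi w'| <= C1 + C1.
pose P v := forall x, L x -> `|x - v - l| < s -> exists p,
  [/\ path e (x - v - l) p,
      forall w, w \in x - v - l :: p -> D (w + l) /\ `|w| < s &
      `|chi (last (x - v - l) p)| <= C1 + `|chi y0|].
suff H : P y.
  move=> /(H _ Lx)[p [ep pD pl]]; case/shortenP: ep pl => q eq uq qp ql.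
  have sq : (size q <= N)%N.
    rewrite -(size_map (fun w => w + l)); apply: leq_trans (leqnSn _) _.
    rewrite -[_.+1]/(size (map (fun w => w + l) (x - y - l :: q))).
    apply: (NP l); first by rewrite map_inj_uniq //; apply: addIr.
    move=> u /mapP[w wq ->]; rewrite addrK; apply: pD.
    by move: wq; rewrite !inE => /orP[->//|/qp ->]; rewrite orbT.
  have := path_variation eq; have : (C1 + C1) *+ size q <= (C1 + C1) *+ N.
    by rewrite ler_wpMn2l // addr_ge0.
  move: ql; move: (chi (last _ q)) => z; rewrite !ler_norml; lra.
have memD u v : L u -> L v -> D (u - v - l + l).
  by move=> Lu Lv; rewrite subrK; exists u => //; exists v.
apply: (@chain_ind _ _ _ _ P _ Lrho Ly0) => // [w Lw ws|u v Lu Lv uv Pu w Lw wvs].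
  exists [::]; split=> //= [z|].
    by rewrite inE => /eqP ->; split=> //; apply: memD.
  have -> : w - y0 - l = w - l - y0 by rewrite addrAC.
  rewrite chiB //; last by apply: genL.
    rewrite (le_trans (ler_normB _ _)) // lerD2r C1P //.
    have -> : w - l = (w - y0 - l) + y0 by rewrite addrAC subrK.
    rewrite (le_lt_trans (ler_normD _ _)) // /step; lra.
  by apply: zgeneratedB; apply: genL.
have [w' Lw' w's] := Lrho.2 (u + l); rewrite opprD addrA in w's.
have w's' : `|w' - u - l| < s by apply: lt_le_trans srho.
have [p [ep pD pl]] := Pu w' Lw' w's'.
exists (w' - u - l :: p); split=> //=.
- apply/andP; split=> //; rewrite /e.
  rewrite !chiB; try by do ?[apply: zgeneratedB]; apply: genL.
  have := C1P w w' Lw Lw'; have := C1P u v Lu Lv; rewrite !chiB; try exact: genL.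
  have us : `|u - v| < step by rewrite /step; lra.
  have ws : `|w - w'| < step.
    have -> : w - w' = (w - v - l) - (w' - u - l) - (u - v).
      by apply/rowP => i; rewrite !mxE; lra.
    rewrite (le_lt_trans (ler_normB _ _)) // /step.
    have := ler_normB (w - v - l) (w' - u - l); lra.
  move=> /(_ us) H1 /(_ ws); move: H1; rewrite !ler_norml; lra.
- move=> z; rewrite inE => /predU1P[->|/pD//].
  by split=> //; apply: memD.
Qed.

(** Choosing a point f v of L near each vector v turns chi into a function
    chi (f v) of v that is additive up to the values of chi on bounded triples. *)
Lemma hom_almost_linear :
  exists (a : 'cV[R]_n) (C : R), forall x, L x -> `|chi x - (x *m a) 0 0| <= C.
Proof.
have /choice[f fP] : forall v, exists y, L y /\ `|y - v| < rho.
  by move=> v; have [y ? ?] := Lrho.2 v; exists y.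
have [C3 C30 C3P] := hom_bounded_on_triples (rho + rho + rho).
have [C2 C20 C2P] := hom_bounded_on_differences rho.
have [C1 C10 C1P] := hom_bounded_on_differences (rho + 1 + `|f 0|).
have fC u v : `|chi (f (u + v)) - chi (f u) - chi (f v)| <= C3.
  have [[[Luv uvP] [Lu uP]] [Lv vP]] := (fP (u + v), fP u, fP v).
  rewrite -chiB; try exact: genL.
  rewrite -chiB; [|by apply: zgeneratedB; apply: genL|exact: genL].
  apply: C3P => //.
  have -> : f (u + v) - f u - f v = (f (u + v) - (u + v)) - (f u - u) - (f v - v).
    by apply/rowP => i; rewrite !mxE; lra.
  rewrite (le_lt_trans (ler_normB _ _)) //.
  have := ler_normB (f (u + v) - (u + v)) (f u - u); lra.
have fB v : `|v| <= 1 -> `|chi (f v)| <= C1 + `|chi (f 0)|.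
  move=> v1; have [[Lv vP] [L0 _]] := (fP v, fP 0).
  have := C1P _ _ Lv L0; rewrite chiB; try exact: genL.
  have fv : `|f v - f 0| < rho + 1 + `|f 0|.
    have -> : f v - f 0 = (f v - v) + v - f 0 by rewrite subrK.
    rewrite (le_lt_trans (ler_normB _ _)) //.
    have := ler_normD (f v - v) v; lra.
  move=> /(_ fv) /= H; have := lexx `|chi (f 0)|; move: H.
  rewrite !ler_norml; lra.
have [a [C aP]] := quasi_additive_linear fC fB.
exists a, (C2 + C) => x Lx; have [Lf fx] := fP x.
have := C2P _ _ Lx Lf; rewrite chiB; try exact: genL.
rewrite distrC => /(_ fx); have := aP x; rewrite /= !ler_norml; lra.
Qed.

End AlmostLinear.

(** * Progressions in subsets of model sets *)

Lemma raddf_zcomb (U V : zmodType) (f : {additive U -> V}) k (r : 'I_k -> U) c :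
  f (zcomb r c) = zcomb (f \o r) c.
Proof. by rewrite raddf_sum; apply: eq_bigr => i _; rewrite raddfMz. Qed.

Section FullyEuclidean.
Context {R : realType}.

Lemma norm_zcomb_le m n (x : 'I_n -> 'rV[R]_m) c :
  `|zcomb x c| <= \sum_i `|x i| * `|(c 0 i)%:~R|.
Proof.
rewrite (le_trans (ler_norm_sum _ _ _)) // ler_sum // => i _.
by rewrite -scaler_int normrZ mulrC.
Qed.

Lemma norm_row_mx_lt d m (x : 'rV[R]_d) (y : 'rV[R]_m) s :
  0 < s -> (`|row_mx x y| < s <-> `|x| < s /\ `|y| < s).
Proof.
move=> s0; split=> [xys|[xs ys]].
  split; apply: norm_lt_coord => // i; apply: le_lt_trans xys.
    by have := coord_le_norm (row_mx x y) (lshift m i); rewrite row_mxEl.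
  by have := coord_le_norm (row_mx x y) (rshift d i); rewrite row_mxEr.
apply: norm_lt_coord => // i; rewrite -(splitK i); case: (fintype.split i) => j /=.
  by rewrite row_mxEl (le_lt_trans (coord_le_norm _ _)).
by rewrite row_mxEr (le_lt_trans (coord_le_norm _ _)).
Qed.

Context {d m : nat} (Lat : zmodClosed ('rV[R]_d * 'rV[R]_m)%type).

(** By translation, the isolation of 0 is uniform over the group. *)
Lemma discrete_separated : [set` Lat] `<=` isolated [set` Lat] ->
  exists2 r, 0 < r & forall p q, p \in Lat -> q \in Lat ->
    `|row_mx p.1 p.2 - row_mx q.1 q.2| < r -> p = q.
Proof.
move=> /(_ 0 (rpred0 _))[_ [V /nbhs_ballP[e /= e0 eV] V0]].
exists e => // p q pL qL; rewrite opp_row_mx add_row_mx norm_row_mx_lt // => -[p1 p2].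
apply/subr0_eq; suff : (V `&` [set` Lat]) (p - q) by rewrite V0.
split; last exact: rpredB.
by apply: eV; split; rewrite -ball_normE /= sub0r normrN.
Qed.

(** The second coordinates of Lat are relatively dense at every scale, so each of
    them is reached from 0 by a chain of small steps. *)
Lemma small_elements_generate (s : R) :
    dense [set p.2 | p in [set` Lat]] -> 0 < s ->
  forall p, p \in Lat -> zgenerated [set p | p \in Lat /\ `|p.2| < s] p.
Proof.
move=> dns s0 p pL; pose S := [set p.2 | p in [set` Lat]].
have SD : dense_within S (s / 3).
  split=> [|x]; first by rewrite divr_gt0 ?ltr0n.
  have [] := dns (ball x (s / 3)).
  - by exists x; apply: ballxx; rewrite divr_gt0 ?ltr0n.
  - exact: ball_open.
  move=> y [xy Sy]; exists y => //.
  by move: xy; rewrite -ball_normE /= distrC.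
pose gen := zgenerated [set p : 'rV[R]_d * 'rV[R]_m | p \in Lat /\ `|p.2| < s].
have S0 : S 0 by exists 0 => //=; apply: rpred0.
suff H y : S y -> forall p, p \in Lat -> p.2 = y -> gen p.
  by apply: (H p.2) => //; exists p.
apply: (chain_ind (P := fun y => forall p, p \in Lat -> p.2 = y -> gen p) SD S0).
  by move=> q qL q2; apply: sub_zgenerated; split=> //; rewrite q2 normr0.
move=> u v [q qL <-] _ uv Pu w wL wv.
rewrite -(subKr q w); apply: zgeneratedB; first exact: Pu.
apply: sub_zgenerated; split; first exact: rpredB.
by rewrite /= wv (lt_le_trans uv) // mulrC divfK // pnatr_eq0.
Qed.

Lemma small_independent (s : R) n (x : 'I_n -> 'rV[R]_d * 'rV[R]_m) :
    dense [set p.2 | p in [set` Lat]] -> 0 < s ->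
    zindependent x -> (forall i, x i \in Lat) ->
  exists r : 'I_n -> 'rV[R]_d * 'rV[R]_m,
    zindependent r /\ forall i, r i \in Lat /\ `|(r i).2| < s.
Proof.
move=> dns s0 xI xL.
apply: (zindependent_in_generators
  (A := [set p | p \in Lat /\ `|p.2| < s]) xI) => i.
exact: small_elements_generate.
Qed.

Lemma rpred_zcomb n (r : 'I_n -> 'rV[R]_d * 'rV[R]_m) c :
  (forall i, r i \in Lat) -> zcomb r c \in Lat.
Proof. by move=> rL; apply: rpred_sum => i _; apply: rpredMz. Qed.

(** A combination z of small independent lattice vectors r is coloured by the
    difference t z between a lattice point q z lying over L, close to zcomb r z,
    and zcomb r z itself.  On a homothetic copy of {0..N}^n where t is constant,
    q z and zcomb r z differ by a constant, so q z runs through a progression. *)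
Lemma subset_model_set_progressions (W : set 'rV[R]_m) (L : set 'rV[R]_d)
    (rho : R) n (b : 'I_n -> 'rV[R]_d) :
    cut_and_project_scheme Lat -> precompact W -> L `<=` curlywedge Lat W ->
    dense_within L rho -> zindependent b -> (forall i, zgenerated L (b i)) ->
  has_li_progressions L n.
Proof.
move=> [[disc _] inj dns] cW LW [rho0 Lrho] bI bL N.
have [B0 B00 WB] : exists2 B, 0 < B & forall y, W y -> `|y| < B.
  move: cW; rewrite precompactE => /compact_bounded[M [_ MW]].
  exists (`|M| + 2) => [|y Wy]; first by rewrite ltr_wpDl.
  rewrite (@le_lt_trans _ _ (`|M| + 1)) ?ltrD2l ?ltr1n //.
  by apply: MW; [rewrite ltr_pwDr // ler_norm | apply: subset_closure].
have /choice[x xP] : forall i, exists p, p \in Lat /\ p.1 = b i.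
  move=> i; pose P (y : 'rV[R]_d) := exists p, p \in Lat /\ p.1 = y.
  apply: (zgenerated_ind (P := P)) (bL i) => [|u v [p [pL <-]] [q [qL <-]]|u /LW[y _ uy]].
  - by exists 0; split=> //; apply: rpred0.
  - by exists (p - q); split=> //; apply: rpredB.
  - by exists (u, y).
have xL i : x i \in Lat := (xP i).1.
have xI : zindependent x.
  apply/zindependentP => c /(congr1 fst); rewrite raddf_zcomb /=.
  rewrite (_ : _ \o _ = b); last by apply/funext => i; rewrite /= (xP i).2.
  by move/zindependentP : bI; apply.
have [r0 r00 sep] := discrete_separated disc.
(* The difference of q z and zcomb r z has first coordinate below rho, and second
   coordinate below B0 + 1. *)
pose s := rho + B0 + 1.
have s0 : 0 < s by rewrite !addr_gt0.
have [F FP] := @bounded_part_finite _ _ _ (fun p : 'rV[R]_d * 'rV[R]_m => row_mx p.1 p.2)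
  [set` Lat] r0 s r00 sep.
pose vs := [seq \row_i ((c i : nat)%:Z) | c : {ffun 'I_n -> 'I_N.+1}].
have [T TP] := @gallai 'rV[int]_n vs ('I_(size F).+1 : finType).
have vs0 : 0 \in vs.
  apply/mapP; exists [ffun=> ord0]; first by rewrite mem_enum.
  by apply/rowP => i; rewrite !mxE ffunE.
pose pts := allpairs (fun q v => q.1 + v *+ q.2) T vs.
have ptsP q v : q \in T -> v \in vs -> q.1 + v *+ q.2 \in pts.
  exact: (@allpairs_f _ _ _ (fun q v => q.1 + v *+ q.2)).
have [M M0 MP] := seq_bounded pts (fun z : 'rV[int]_n => \sum_i `|(z 0 i)%:~R : R|).
(* With axes this short, every point of pts gives a lattice element whose second
   coordinate is below 1. *)
have e0 : 0 < (M + 1)^-1 by rewrite invr_gt0 ltr_wpDl.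
have [r [rI rP]] := small_independent dns e0 xI xL.
have rL i : r i \in Lat := (rP i).1.
have small z : z \in pts -> `|(zcomb r z).2| < 1.
  move=> /MP; rewrite ger0_norm; last by apply: sumr_ge0 => i _.
  move=> zM; rewrite raddf_zcomb (le_lt_trans (norm_zcomb_le _ _)) //.
  apply: (@le_lt_trans _ _ ((M + 1)^-1 * M)); last first.
    by rewrite mulrC ltr_pdivrMr ?mul1r ?ltrDl // ltr_wpDl.
  apply: le_trans (ler_wpM2l (ltW e0) zM); rewrite mulr_sumr ler_sum // => i _.
  by rewrite ler_wpM2r // ltW //; have [] := rP i.
have /choice[q qP] : forall z, exists q, [/\ q \in Lat, L q.1,
    `|q.1 - (zcomb r z).1| < rho & `|q.2| < B0].
  move=> z; have [y Ly yz] := Lrho (zcomb r z).1.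
  by have [w Ww yw] := LW _ Ly; exists (y, w); split=> //; apply: WB.
have [t tq] : exists t, forall z, t z = q z - zcomb r z.
  by exists (fun z => q z - zcomb r z).
have tF z : z \in pts -> t z \in F.
  move=> zp; have [qL _ q1 q2] := qP z; apply/FP; rewrite tq; split.
    by apply: rpredB => //; apply: rpred_zcomb.
  rewrite norm_row_mx_lt //; split; rewrite /=; first by rewrite (lt_trans q1) // /s; lra.
  rewrite (le_lt_trans (ler_normB _ _)) //; have := small _ zp; rewrite /s; lra.
(* The extra colour is for the z outside pts, whose t z may lie outside F. *)
pose col z : 'I_(size F).+1 := inord (index (t z) F).
have colE z : z \in pts -> nth 0 F (col z) = t z.
  by move=> /tF zF; rewrite inordK ?nth_index // ltnS index_size.
have [[a e] aT /andP[/= e_gt0 /allP mono]] := TP col.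
have ap : a \in pts by have := ptsP _ _ aT vs0; rewrite /= mul0rn addr0.
have tE v : v \in vs -> t (a + v *+ e) = t a.
  move=> vvs; have vp := ptsP _ _ aT vvs.
  by rewrite -(colE _ vp) -(colE _ ap) (eqP (mono _ vvs)).
exists [set (q a).1 + \sum_j ((r j).1 *+ e) *~ c j |
           c in [set c : 'I_n -> int | forall j, 0 <= c j <= N%:Z]].
  exists (q a).1, (fun j => (r j).1 *+ e); split=> // c c0 i.
  have c0' : zcomb r (\row_j (c j * e%:Z)) = 0.
    apply: inj; [exact: rpred_zcomb|exact: rpred0|].
    rewrite raddf_zcomb -[RHS]c0; apply: eq_bigr => j _.
    by rewrite mxE mulrC mulrzA.
  have /rowP/(_ i) := (zindependentP r).1 rI _ c0'; rewrite !mxE => /eqP.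
  by rewrite mulf_eq0 => /orP[/eqP//|/eqP[eE]]; rewrite eE in e_gt0.
move=> _ [c cN <-].
have vvs : \row_j c j \in vs.
  apply/mapP; exists [ffun j => inord `|c j|%N]; first by rewrite mem_enum.
  apply/rowP => j; have /andP[cj0 cjN] := cN j.
  by rewrite !mxE ffunE inordK ?gez0_abs // ltnS -lez_nat gez0_abs.
have [_ Lq _ _] := qP (a + (\row_j c j) *+ e).
suff <- : (q (a + (\row_j c j) *+ e)).1 =
    (q a).1 + \sum_j ((r j).1 *+ e) *~ c j by [].
have -> : q (a + (\row_j c j) *+ e) = q a + zcomb r ((\row_j c j) *+ e).
  apply/(addIr (- zcomb r (a + (\row_j c j) *+ e))).
  rewrite -tq tE // tq zcombD opprD addrACA.
  by rewrite subrr addr0.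
rewrite raddfD /= raddf_zcomb; congr (_ + _); apply: eq_bigr => j _.
by rewrite -scaler_nat !mxE /= natz mulrzA.
Qed.

End FullyEuclidean.

(** * Model sets from long progressions *)

(** On row vectors, 1 - B A is the projection onto the kernel of B along the row
    space of A; a full rank factorisation Q D of this projection gives
    coordinates on that kernel. *)
Lemma complementary_splitting (F : fieldType) d n (A : 'M[F]_(d, n)) (B : 'M[F]_(n, d)) :
  A *m B = 1%:M -> exists m (Q : 'M[F]_(n, m)) (D : 'M[F]_(m, n)),
    [/\ A *m Q = 0, D *m B = 0, D *m Q = 1%:M & B *m A + Q *m D = 1%:M].
Proof.
move=> AB; pose E := 1%:M - B *m A.
have QD : col_base E *m row_base E = E := mulmx_base E.
have AE : A *m E = 0 by rewrite mulmxBr mulmx1 mulmxA AB mul1mx subrr.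
have EB : E *m B = 0 by rewrite mulmxBl mul1mx -mulmxA AB mulmx1 subrr.
have EE : E *m E = E by rewrite {1}/E mulmxBl mul1mx -mulmxA AE mulmx0 subr0.
have Dfree := row_base_free E; have Qfull := col_base_full E.
exists (\rank E), (col_base E), (row_base E); split.
- by apply: (row_free_inj Dfree); rewrite mul0mx -mulmxA QD.
- by apply: (row_full_inj Qfull); rewrite mulmx0 mulmxA QD.
- apply: (row_free_inj Dfree); apply: (row_full_inj Qfull).
  rewrite mul1mx.
  have -> : col_base E *m (row_base E *m col_base E *m row_base E) =
      (col_base E *m row_base E) *m (col_base E *m row_base E) by rewrite !mulmxA.
  by rewrite QD EE.
- by rewrite QD addrC subrK.
Qed.

Definition embedded_lattice (R : realType) n d m (B : 'M[R]_(n, d))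
    (Q : 'M[R]_(n, m)) : {pred 'rV[R]_d * 'rV[R]_m} :=
  fun p => `[< exists z : 'rV[int]_n,
    p = (map_mx intr z *m B, map_mx intr z *m Q) >].

Lemma embedded_lattice_closed (R : realType) n d m (B : 'M[R]_(n, d))
  (Q : 'M[R]_(n, m)) : zmod_closed (embedded_lattice B Q).
Proof.
split=> [|p q /asboolP[z ->] /asboolP[w ->]]; apply/asboolP.
  by exists 0; rewrite map_mx0 !mul0mx.
by exists (z - w); rewrite map_mxB !mulmxBl.
Qed.

HB.instance Definition _ (R : realType) n d m (B : 'M[R]_(n, d))
    (Q : 'M[R]_(n, m)) :=
  GRing.isZmodClosed.Build _ (embedded_lattice B Q) (embedded_lattice_closed B Q).

Lemma int_norm_lt1 (R : numDomainType) (z : int) : `|z%:~R : R| < 1 -> z = 0.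
Proof. by rewrite -intr_norm -[1]/(1%:~R) ltr_int; lia. Qed.

Lemma mulmx_continuous (R : realType) k l (M : 'M[R]_(k, l)) :
  continuous (fun w : 'rV[R]_k => w *m M).
Proof.
have [K K0 KP] := norm_mulmx_le M => w.
apply/(@cvgrPdist_le _ _ _ (nbhs w) (nbhs_filter w)) => e e0.
have e1 : 0 < e / (K + 1) by rewrite divr_gt0 // ltr_wpDl.
have := nbhsx_ballx w _ e1; apply: filterS => v; rewrite -ball_normE /= => wv.
rewrite -mulmxBl (le_trans (KP _)) // (le_trans (ler_wpM2l K0 (ltW wv))) //.
rewrite mulrCA -[leRHS]mulr1 ler_wpM2l ?(ltW e0) //.
by rewrite ler_pdivrMr ?mul1r ?lerDl // ltr_wpDl.
Qed.

Section Lattice.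
Context {R : realType} {n d m : nat}.
Variables (B : 'M[R]_(n, d)) (Q : 'M[R]_(n, m)).
Variables (A : 'M[R]_(d, n)) (D : 'M[R]_(m, n)).

Hypothesis BAQD : B *m A + Q *m D = 1%:M.

Lemma splitting_sum (w : 'rV[R]_n) : (w *m B) *m A + (w *m Q) *m D = w.
Proof. by rewrite -!mulmxA -mulmxDr BAQD mulmx1. Qed.

Lemma embedded_lattice_discrete :
  [set` embedded_lattice B Q] `<=` isolated [set` embedded_lattice B Q].
Proof.
move=> p pL; split; first by rewrite inE.
have [KA KA0 KAP] := norm_mulmx_le A; have [KD KD0 KDP] := norm_mulmx_le D.
pose e := (KA + KD + 1)^-1; have e0 : 0 < e by rewrite invr_gt0 ltr_wpDl // addr_ge0.
exists (ball p e); first exact: nbhsx_ballx.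
apply/seteqP; split=> [q [pq qL]|_ ->]; last by split=> //; apply: ballxx.
case: pq; rewrite -!ball_normE /= => pq1 pq2; apply/esym/subr0_eq.
have /asboolP[z zE] : p - q \in embedded_lattice B Q by apply: rpredB.
have z1 : `|map_mx intr z : 'rV[R]_n| < 1.
  rewrite -[map_mx _ _]splitting_sum; move/(congr1 fst): (zE) => /= <-.
  move/(congr1 snd): (zE) => /= <-; rewrite (le_lt_trans (ler_normD _ _)) //.
  have /lt_le_trans : KA * `|p.1 - q.1| + KD * `|p.2 - q.2| < 1.
    apply: (@le_lt_trans _ _ (KA * e + KD * e)).
      by rewrite lerD // ler_wpM2l // ltW.
    by rewrite -mulrDl /e ltr_pdivrMr ?mul1r ?ltrDl // ltr_wpDl // addr_ge0.
  move=> H; apply: le_lt_trans (H _ (lexx _)); exact: lerD.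
suff z0 : z = 0 by rewrite zE z0 map_mx0 !mul0mx.
apply/rowP => i; have := le_lt_trans (coord_le_norm _ i) z1.
by rewrite !mxE => /int_norm_lt1.
Qed.

Hypotheses (AB : A *m B = 1%:M) (AQ : A *m Q = 0).
Hypotheses (DB : D *m B = 0) (DQ : D *m Q = 1%:M).

(** The quotient is the image of the unit cube of R^n. *)
Lemma embedded_lattice_cocompact :
  compact [set: quotient_topology (Quotient.quot (embedded_lattice B Q))].
Proof.
pose f (w : 'rV[R]_n) := (w *m B, w *m Q).
pose cls p : quotient_topology (Quotient.quot (embedded_lattice B Q)) :=
  (\pi_(quotient_topology (Quotient.quot (embedded_lattice B Q))) p)%qT.
have clsE p q : p - q \in embedded_lattice B Q -> cls p = cls q.
  by rewrite Quotient.idealrBE => /eqP.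
pose cube := [set w : 'rV[R]_n | forall i, `[0, 1]%classic (w ord0 i)].
have cf : continuous (cls \o f).
  move=> w; apply: (@continuous_comp _ _ _ f cls); last exact: pi_continuous.
  by apply: (@cvg_pair _ _ _ (nbhs w) (nbhs (w *m B)) (nbhs (w *m Q)) _ _ _
    (fun v => v *m B) (fun v => v *m Q)); apply: mulmx_continuous.
have -> : [set: quotient_topology (Quotient.quot (embedded_lattice B Q))] =
    (cls \o f) @` cube.
  apply/seteqP; split=> // c _; pose p := repr c.
  pose w := p.1 *m A + p.2 *m D; pose z : 'rV[int]_n := \row_i Num.floor (w 0 i).
  exists (w - map_mx intr z) => [i|].
    have /andP[] := floor_itv (w 0 i); rewrite intrD /= !mxE in_itv /=.
    by move=> ? ?; apply/andP; split; lra.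
  rewrite -[RHS](@reprK _ (Quotient.quot (embedded_lattice B Q))).
  apply: clsE; apply/asboolP; exists (- z).
  rewrite /f map_mxN !mulmxBl !mulNmx /w !mulmxDl -!mulmxA AB AQ DB DQ.
  rewrite !mulmx0 !mulmx1 addr0 add0r.
  by apply: injective_projections; rewrite /= addrAC subrr add0r.
have ccube : compact cube.
  by apply: (@rV_compact R n (fun=> `[0, 1]%classic)) => _; apply: segment_compact.
by apply: continuous_compact ccube; apply: continuous_subspaceT.
Qed.

(** The rows of M Q span R^m because M is invertible over R.  Writing y as a
    combination of these short vectors and rounding the coefficients down
    changes it by less than the sum of their norms. *)
Lemma small_independent_dense :
    (forall e : R, 0 < e -> exists2 M : 'M[int]_n, \det M != 0 &
       forall j, `|row j (map_mx intr M) *m Q| < e) ->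
  dense [set p.2 | p in [set` embedded_lattice B Q]].
Proof.
move=> small O [y Oy] oO; have /nbhs_ballP[e /= e0 eO] : nbhs y O by apply: open_nbhs_nbhs.
have e1 : 0 < e / n.+1%:R by rewrite divr_gt0 ?ltr0n.
have [M M0 Me] := small _ e1.
pose MR : 'M[R]_n := map_mx intr M.
have uM : MR \in unitmx by rewrite unitmxE det_map_mx unitfE intr_eq0.
have [t tM] : exists t, t *m MR = y *m D.
  by exists (y *m D *m invmx MR); rewrite mulmxKV.
pose z : 'rV[int]_n := \row_i Num.floor (t 0 i).
exists (map_mx intr (z *m M) *m Q); split; last first.
  exists (map_mx intr (z *m M) *m B, map_mx intr (z *m M) *m Q) => //=.
  by apply/asboolP; exists (z *m M).
apply: eO; rewrite -ball_normE /=.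
have -> : y - map_mx intr (z *m M) *m Q = (t - map_mx intr z) *m (MR *m Q).
  rewrite mulmxBl map_mxM !mulmxA; congr (_ - _).
  by rewrite tM -mulmxA DQ mulmx1.
rewrite [_ *m (MR *m Q)]mulmx_sum_row (le_lt_trans (ler_norm_sum _ _ _)) //.
apply: (@le_lt_trans _ _ (\sum_(i < n) e / n.+1%:R)).
  apply: ler_sum => i _; rewrite normrZ row_mul -[leRHS]mul1r ler_pM ?(ltW (Me i)) //.
  have /andP[] := floor_itv (t 0 i); rewrite intrD !mxE /= => ? ?.
  by rewrite ger0_norm; lra.
rewrite sumr_const card_ord -[_ *+ n]mulr_natl mulrCA -[ltRHS]mulr1 ltr_pM2l //.
by rewrite ltr_pdivrMr ?ltr0n // mul1r ltr_nat.
Qed.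

End Lattice.

Lemma progression_axes (V : zmodType) (L : set V) (k N : nat) :
    has_li_progressions L k ->
  exists s (r : 'I_k -> V), [/\ zindependent r, L s &
    forall j c, (c <= N)%N -> L (s + r j *+ c)].
Proof.
move=> /(_ N)[_ [s [r [rI ->]]] rL]; exists s, r; split=> // [|j c cN].
  by apply: rL; exists (fun=> 0) => //; rewrite big1 ?addr0 // => j _; exact: mulr0z.
apply: rL; exists (fun i => if i == j then c%:Z else 0).
  by move=> i; case: eqP => // _; rewrite lez_nat cN.
by rewrite (bigD1 j) //= eqxx big1 ?addr0 // => i /negbTE ->; exact: mulr0z.
Qed.

Lemma axis_zgenerated (V : zmodType) (L : set V) (s r : V) :
  L s -> L (s + r *+ 1) -> zgenerated L r.
Proof.
move=> Ls Lsr; have -> : r = s + r *+ 1 - s by rewrite mulr1n addrC addKr.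
by apply: zgeneratedB; apply: sub_zgenerated.
Qed.

Section Converse.
Context {R : realType}.

Lemma linear_bounded_eq0 d k (T : 'M[R]_(d, k)) (L : set 'rV[R]_d) (rho C : R) :
  dense_within L rho -> (forall x, L x -> `|x *m T| <= C) -> T = 0.
Proof.
move=> [rho0 Lrho] TC; have [K K0 KP] := norm_mulmx_le T.
apply/row_matrixP => i; rewrite row0; apply/eqP; rewrite -normr_le0.
rewrite rowE; set v := delta_mx 0 i; rewrite leNgt; apply/negP => vT0.
pose N := (Num.truncn ((C + K * rho) / `|v *m T|)).+1.
have : N%:R * `|v *m T| <= C + K * rho.
  have [x Lx xv] := Lrho (N%:R *: v).
  rewrite -[N%:R]ger0_norm // -normrZ scalemxAl.
  have -> : N%:R *: v *m T = x *m T - (x - N%:R *: v) *m T by rewrite -mulmxBl subKr.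
  rewrite (le_trans (ler_normB _ _)) // lerD ?TC // (le_trans (KP _)) //.
  by rewrite ler_wpM2l // ltW.
rewrite leNgt -ltr_pdivrMr // => /negP; apply.
have q0 : 0 <= (C + K * rho) / `|v *m T|.
  have [x Lx _] := Lrho 0; rewrite divr_ge0 // addr_ge0 ?mulr_ge0 ?(ltW rho0) //.
  by apply: le_trans (TC x Lx).
by have /andP[] := truncn_itv q0.
Qed.

Lemma almost_linear_coordinates d n (L : set 'rV[R]_d) (b : 'I_n -> 'rV[R]_d)
    (rho r : R) :
    dense_within L rho -> separated [set x - y | x in L & y in L] r ->
    zbasis (zgenerated L) b ->
  exists (phi : 'rV[R]_d -> 'rV[int]_n) (A : 'M[R]_(d, n)) (C : R),
    (forall x, zgenerated L x -> zcomb b (phi x) = x) /\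
    forall x, L x -> `|map_mx intr (phi x) - x *m A| <= C.
Proof.
move=> Lrho Dr [/zindependentP bI bG].
have /choice[phi phiP] : forall x, exists c, zgenerated L x -> zcomb b c = x.
  move=> x; have [Gx|nGx] := pselect (zgenerated L x); last by exists 0.
  by move: Gx; rewrite bG => /zspanP[c ->]; exists c.
have phiB x y : zgenerated L x -> zgenerated L y -> phi (x - y) = phi x - phi y.
  move=> Gx Gy; apply/subr0_eq/bI.
  by rewrite !zcombB !phiP ?subrr //; apply: zgeneratedB.
have /choice[a /choice[C aC]] i : exists (a : 'cV[R]_d) (C : R),
    forall x, L x -> `|(phi x 0 i)%:~R - (x *m a) 0 0| <= C.
  apply: (hom_almost_linear (chi := fun x => (phi x 0 i)%:~R) Lrho Dr) => x y Gx Gy.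
  by rewrite phiB // !mxE intrB.
exists phi, (\matrix_(j, i) a i j 0), (\sum_i `|C i|); split=> // x Lx.
apply: norm_le_coord => [|i]; first by apply: sumr_ge0.
have := aC i x Lx; rewrite !mxE.
under [in X in _ -> X]eq_bigr do rewrite mxE.
move=> /le_trans; apply; rewrite (bigD1 i) //= (le_trans (ler_norm _)) //.
by rewrite lerDl sumr_ge0.
Qed.

(** In the coordinates phi of G, with R^n written as row vectors, B is the map
    from R^n to R^d that gives back the points of G, and x |-> x A is the linear
    approximation of phi on L.  Boundedness of phi x - x A forces A B = 1, so A
    is a section of B and its complement provides the internal space. *)
Lemma progressions_fully_euclidean d n (L : set 'rV[R]_d) (b : 'I_n -> 'rV[R]_d) :
    meyer L -> zbasis (zgenerated L) b -> has_li_progressions L n ->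
  fully_euclidean_meyer L.
Proof.
move=> [Lrd /uniformly_discrete_separated[r Dr]] bG ap; split=> //.
have [rho Lrho] := relatively_dense_within Lrd.
have [phi [A [C [phiP AC]]]] := almost_linear_coordinates Lrho Dr bG.
have genL x : L x -> zgenerated L x := @sub_zgenerated _ L x.
pose B : 'M[R]_(n, d) := \matrix_i b i.
have BE z : map_mx intr z *m B = zcomb b z.
  rewrite mulmx_sum_row; apply: eq_bigr => i _.
  by rewrite rowK !mxE scaler_int.
have phiB x : L x -> map_mx intr (phi x) *m B = x by move=> /genL Gx; rewrite BE phiP.
have [KB KB0 KBP] := norm_mulmx_le B.
have AB : A *m B = 1%:M.
  apply/subr0_eq/(linear_bounded_eq0 (C := KB * C) Lrho) => x Lx.
  have -> : x *m (A *m B - 1%:M) = - ((map_mx intr (phi x) - x *m A) *m B).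
    by rewrite mulmxBr mulmx1 mulmxBl phiB // mulmxA opprB.
  by rewrite normrN (le_trans (KBP _)) // ler_wpM2l // AC.
have [m [Q [D [AQ DB DQ BAQD]]]] := complementary_splitting AB.
have [K K0 KP] := norm_mulmx_le Q.
have C0 : 0 <= C by have [x Lx _] := Lrho.2 0; apply: le_trans (AC x Lx).
have star x : L x -> `|map_mx intr (phi x) *m Q| <= K * C.
  move=> Lx; have -> : map_mx intr (phi x) *m Q = (map_mx intr (phi x) - x *m A) *m Q.
    by rewrite mulmxBl -mulmxA AQ mulmx0 subr0.
  by rewrite (le_trans (KP _)) // ler_wpM2l // AC.
have bI := (zindependentP b).1 bG.1.
exists (curlywedge (embedded_lattice B Q) (ball 0 (K * C + 1))); last first.
  move=> x Lx; exists (map_mx intr (phi x) *m Q).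
    by rewrite -ball_normE /= sub0r normrN (le_lt_trans (star _ Lx)) // ltrDl.
  by apply/asboolP; exists (phi x); rewrite phiB.
exists m, (GRing.ZmodClosed.clone _ (embedded_lattice B Q) _), (ball 0 (K * C + 1)).
have KC0 : 0 < K * C + 1 by rewrite ltr_wpDl // mulr_ge0.
split=> //; last first.
- by exists 0; apply: nbhsx_ballx.
- rewrite precompactE; apply: bounded_closed_compact; last exact: closed_closure.
  rewrite -/(closed_ball _ _) closed_ballE //.
  exists (K * C + 1); split=> [|u Ku y]; first exact: num_real.
  by rewrite /closed_ball_ /= sub0r normrN => /le_trans; apply; apply: ltW.
split.
- split; first exact: embedded_lattice_discrete BAQD.
  exact: embedded_lattice_cocompact AB AQ DB DQ.
- move=> _ _ /asboolP[z ->] /asboolP[w ->] /=; rewrite !BE => zw.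
  suff -> : z = w by [].
  by apply/subr0_eq/bI; rewrite zcombB zw subrr.
apply: (@small_independent_dense _ _ _ _ B Q D DQ) => e e0.
pose N := (Num.truncn ((K * C + K * C) / e)).+1.
(* N is such that (KC + KC) / N < e, where KC bounds the R^m-components on L. *)
have [s [x [xI sL sxL]]] := progression_axes N ap.
have xG j : zgenerated L (x j) by apply: axis_zgenerated sL (sxL j 1 isT).
pose M : 'M[int]_n := \matrix_j phi (x j).
exists M => [|j].
  apply/det0P => -[v /eqP v0 vM]; apply: v0.
  apply: (zindependentP x).1 => //.
  rewrite (_ : x = fun j => zcomb b (row j M)); last first.
    by apply/funext => j; rewrite rowK phiP.
  by rewrite zcomb_mulmx vM zcomb0.
have phiN : phi (s + x j *+ N) = phi s + N%:Z *: phi (x j).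
  apply/subr0_eq/bI; rewrite zcombB zcombD zcombZ !phiP ?subrr //; apply: genL => //.
  exact: sxL.
have := ler_normB (map_mx intr (phi (s + x j *+ N)) *m Q) (map_mx intr (phi s) *m Q).
have -> : map_mx intr (phi (s + x j *+ N)) *m Q - map_mx intr (phi s) *m Q =
    N%:R *: (row j (map_mx intr M) *m Q).
  by rewrite -mulmxBl phiN map_mxD map_mxZ addrC addKr -scalemxAl -map_row rowK.
rewrite normrZ ger0_norm // => xN.
have {xN} : N%:R * `|row j (map_mx intr M) *m Q| <= K * C + K * C.
  by rewrite (le_trans xN) // lerD // star //; apply: sxL.
rewrite mulrC -ler_pdivlMr ?ltr0n // => /le_lt_trans; apply.
rewrite ltr_pdivrMr ?ltr0n // (mulrC e) -ltr_pdivrMr //.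
have q0 : 0 <= (K * C + K * C) / e by rewrite divr_ge0 ?(ltW e0) // addr_ge0 // mulr_ge0.
by have /andP[] := truncn_itv q0.
Qed.

End Converse.

(** * The rank of arithmetic progressions *)

Section ApRank.
Context {V : zmodType}.
Implicit Types L : set V.

Lemma has_li_progressions0 L : L !=set0 -> has_li_progressions L 0.
Proof.
move=> [s Ls] N.
exists [set s + \sum_j (fun=> 0 : V) j *~ c j |
         c in [set c : 'I_0 -> int | forall j, 0 <= c j <= N%:Z]].
  by exists s, (fun=> 0); split=> // c _ [].
by move=> _ [c _ <-]; rewrite big_ord0 addr0.
Qed.

Lemma has_li_progressions_leq L n (b : 'I_n -> V) k :
  zbasis (zgenerated L) b -> has_li_progressions L k -> (k <= n)%N.
Proof.
move=> bG /(progression_axes 1)[s [r [rI Ls Lsr]]].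
apply: (zindependent_leq bG rI) => j.
exact: axis_zgenerated Ls (Lsr j 1%N isT).
Qed.

Lemma ap_rank_eq L n :
    L !=set0 -> (forall k, has_li_progressions L k -> (k <= n)%N) ->
  ap_rank L = n <-> has_li_progressions L n.
Proof.
move=> L0 Ln; pose S := [set k | has_li_progressions L k /\
  forall j, has_li_progressions L j -> (j <= k)%N].
have SP : S (ap_rank L).
  have ex0 : exists k, `[< has_li_progressions L k >].
    by exists 0%N; apply/asboolP; apply: has_li_progressions0.
  have bnd k : `[< has_li_progressions L k >] -> (k <= n)%N by move=> /asboolP /Ln.
  apply: (@getPex _ S); case: (ex_maxnP ex0 bnd) => k /asboolP Lk kmax.
  by exists k; split=> // j /asboolP /kmax.
split=> [<-|Lap]; first exact: SP.1.
by apply/eqP; rewrite eqn_leq Ln ?SP.2 //; exact: SP.1.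
Qed.

End ApRank.

Theorem theorem6p1 (R : realType) (d : nat) (hd : (1 <= d)%N)
    (Lambda : set 'rV[R]_d) (hLambda : meyer Lambda) :
  fully_euclidean_meyer Lambda <-> ap_rank Lambda = rank Lambda.
Proof.
have [b bG] := meyer_zbasis hLambda.
have [rho Lrho] := relatively_dense_within hLambda.1.
have L0 : Lambda !=set0 by have [x Lx _] := Lrho.2 0; exists x.
rewrite (ap_rank_eq L0 (fun k => has_li_progressions_leq bG)); split; last first.
  exact: progressions_fully_euclidean bG.
move=> [_ [_ [m [Lat [W [cps cW _ ->]]]] LW]].
apply: (subset_model_set_progressions cps cW LW Lrho bG.1) => i.
by rewrite bG.2; apply: zspan_mem.
Qed.
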